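(* Consider the heterogeneous diffusion network described in the context, with $N$ nodes, combination matrix $C'=[c'_{i,j}]$, set $S$ of sparsity-aware nodes, $N_s=|S|$, common step-size $\mu$ and zero-attracting coefficient $\rho$. Assume: (I.A) $C'$ is doubly stochastic: for all $i,j$, $\sum_{i=1}^N c'_{i,j}=1$ and $\sum_{j=1}^N c'_{i,j}=1$. (I.B) The sparsity-aware nodes are distributed over the network in such a way that $\sum_{i\in S}c'_{i,j}=\frac{N_s}{N}$ for every $j$. (II.B) $E[\mathrm{sgn}[w_i(\infty)]\,\mathrm{sgn}[w_m^T(\infty)]]\approx\boldsymbol\psi$, where $\boldsymbol\psi$ is an $M\times M$ matrix independent of $i$ and $m$, for all $i,m$ such that $m\in\aleph_j$ for some $j\in\aleph_i$; that is, for any pair of nodes having overlapping neighborhoods (including directly connected nodes, and the same node). Let $C=C'\otimes I_{M}$, let $\boldsymbol\Omega_s=\mathrm{diag}[\rho_1 I_M,\dots,\rho_N I_M]$ with $\rho_k=\rho$ if $k\in S$ and $\rho_k=0$ otherwise, and define $$\beta_1(\infty)=\mu^2E\big[\mathrm{sgn}[w(\infty)]^T\boldsymbol\Omega_s C C^T\boldsymbol\Omega_s\,\mathrm{sgn}[w(\infty)]\big].$$ Then $$\beta_1(\infty)=\frac{\mu^2\rho^2\,\mathrm{Tr}[\boldsymbol\psi]\,N_s^2}{N}.$$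
   Context: Setting: a connected network of $N$ nodes. $\aleph_k$ is the set of nodes in the neighborhood of node $k$ (nodes directly connected to $k$), including $k$ itself. The combination coefficients satisfy $c'_{l,k}>0$ if $l\in\aleph_k$, $c'_{l,k}=0$ otherwise, and $\sum_{l\in\aleph_k}c'_{l,k}=1$. Node $k$ observes $d_k(n)=u_k(n)^Tw_0+v_k(n)$, where $w_0\in\mathbb{R}^M$ is an unknown vector, known a priori to be sparse, and the Gaussian inputs $u_k(n)$ and noises $v_k(n)$ are spatially and temporally i.i.d. with variances $\sigma_u^2$ and $\sigma_v^2$ (input and noise mutually independent). It maintains an estimate $w_k(n)\in\mathbb{R}^M$ of $w_0$ by the adapt-then-combine recursion: with $e_k(n)=d_k(n)-w_k(n)^Tu_k(n)$, form the intermediate estimate $z_k(n+1)=w_k(n)+\mu u_k(n)e_k(n)-\rho_k\,\mathrm{sgn}[w_k(n)]$, then set $w_k(n+1)=\sum_{j\in\aleph_k}c'_{j,k}z_j(n+1)$. The step-size $\mu$ is the same at all nodes, and $\rho$ is a very small positive constant. $S$ is the set of indices of the sparsity-aware nodes ($\rho_k=\rho$ for $k\in S$); the other nodes are sparsity-agnostic ($\rho_k=0$ for $k\notin S$). The argument $\infty$ denotes steady state. $w(\infty)\in\mathbb{R}^{MN}$ is the column stacking of $w_1(\infty),\dots,w_N(\infty)$. $\mathrm{sgn}[\cdot]$ acts componentwise; $\otimes$ is the Kronecker product (the $(i,j)$ block of $C'\otimes I_M$ is $c'_{i,j}I_M$); $\mathrm{Tr}$ is the trace. As in the source, assumption (II.B)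 is an approximation, while the conclusion is written with an equality sign.
   Formalization: Assumption (II.B), stated with ''≈'', is read as exact equality for the stated formula; if it holds only entrywise up to a tolerance ε, the formula is asserted up to an error of μ²ρ²(Mε)N_s²/N, since exact equality cannot follow from an approximation. E at ∞ means the limit of E at time n. *)

(* Defs.v *)
From HB Require Import structures.
From mathcomp Require Import all_boot all_order all_algebra.
From mathcomp Require Import all_classical all_reals all_analysis.
From mathcomp Require Import mxtens.
Set Implicit Arguments.
Unset Strict Implicit.
Unset Printing Implicit Defensive.
Import Order.TTheory GRing.Theory Num.Theory.
Import numFieldNormedType.Exports.
Local Open Scope classical_set_scope.
Local Open Scope ring_scope.

(* An undirected network on the nodes 'I_N is given by its adjacency relation
   [e], with no self-loops; a node nevertheless belongs to its own
   neighborhood. *)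
Definition connected_network (N : nat) (e : rel 'I_N) : Prop :=
  [/\ symmetric e, irreflexive e & forall i j, connect e i j].

Definition neighborhood (N : nat) (e : rel 'I_N) (k : 'I_N) : {set 'I_N} :=
  [set l | (l == k) || e k l].

Definition overlapping (N : nat) (e : rel 'I_N) (i m : 'I_N) : Prop :=
  exists2 j, j \in neighborhood e i & m \in neighborhood e j.

(* [c l k] is the weight that node [k] gives to node [l], so it is the columns
   that are normalized. *)
Definition combination_matrix (R : realType) (N : nat) (e : rel 'I_N)
    (c : 'M[R]_N) : Prop :=
  forall k,
    [/\ forall l, l \in neighborhood e k -> 0 < c l k,
        forall l, l \notin neighborhood e k -> c l k = 0 &
        \sum_(l in neighborhood e k) c l k = 1].

Definition doubly_stochastic (R : realType) (N : nat) (c : 'M[R]_N) : Prop :=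
  (forall j, \sum_i c i j = 1) /\ (forall i, \sum_j c i j = 1).

Definition zero_attractor (R : realType) (N : nat) (S : {set 'I_N}) (rho : R)
    (k : 'I_N) : R :=
  if k \in S then rho else 0.

(* Componentwise sign, with sgn 0 = 0. *)
Definition sgnv (R : realType) (m : nat) (x : 'cV[R]_m) : 'cV[R]_m :=
  map_mx Num.sg x.

Definition observation (R : realType) (M : nat) (w0 u : 'cV[R]_M) (v : R) : R :=
  (u^T *m w0) 0 0 + v.

Definition adapt (R : realType) (M : nat) (mu rho : R) (w u : 'cV[R]_M)
    (d : R) : 'cV[R]_M :=
  let err := d - (w^T *m u) 0 0 in
  w + (mu * err) *: u - rho *: sgnv w.

(* Adapt-then-combine recursion driven by given input and desired sequences
   [u] and [d], from the initial estimates [w_init]. *)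
Fixpoint atc (R : realType) (N M : nat) (e : rel 'I_N) (c : 'M[R]_N)
    (rho : 'I_N -> R) (mu : R) (u : nat -> 'I_N -> 'cV[R]_M)
    (d : nat -> 'I_N -> R) (w_init : 'I_N -> 'cV[R]_M) (n : nat) (k : 'I_N)
    : 'cV[R]_M :=
  if n is n'.+1 then
    let w := atc e c rho mu u d w_init n' in
    \sum_(j in neighborhood e k)
      c j k *: adapt mu (rho j) (w j) (u n' j) (d n' j)
  else w_init k.

Definition random_vector d (T : measurableType d) (R : realType)
    (P : probability T R) (M : nat) (X : 'I_M -> {RV P >-> R}) (t : T)
    : 'cV[R]_M :=
  \col_a X a t.

(* The random estimates: the pathwise recursion run along the sample point. *)
Definition estimate d (T : measurableType d) (R : realType)
    (P : probability T R) (N M : nat) (e : rel 'I_N) (c : 'M[R]_N)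
    (rho : 'I_N -> R) (mu : R) (w0 : 'cV[R]_M)
    (u : nat -> 'I_N -> 'I_M -> {RV P >-> R}) (v : nat -> 'I_N -> {RV P >-> R})
    (w_init : 'I_N -> 'I_M -> {RV P >-> R})
    (n : nat) (k : 'I_N) (t : T) : 'cV[R]_M :=
  atc e c rho mu
    (fun n k => random_vector (u n k) t)
    (fun n k => observation w0 (random_vector (u n k) t) (v n k t))
    (fun k => random_vector (w_init k) t) n k.

Definition mutually_independent d (T : measurableType d) (R : realType)
    (P : probability T R) (I : eqType) (X : I -> {RV P >-> R}) : Prop :=
  forall (J : seq I) (A : I -> set R),
    uniq J -> (forall i, measurable (A i)) ->
    P (\bigcap_(i in [set` J]) (X i @^-1` A i)) =
    (\prod_(i <- J) P (X i @^-1` A i))%E.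

Definition is_gaussian d (T : measurableType d) (R : realType)
    (P : probability T R) (X : {RV P >-> R}) (m sigma : R) : Prop :=
  forall A : set R, measurable A -> distribution P X A = normal_prob m sigma A.

(* All scalar sources: the components of the inputs, and the noises. *)
Definition source d (T : measurableType d) (R : realType)
    (P : probability T R) (N M : nat)
    (u : nat -> 'I_N -> 'I_M -> {RV P >-> R}) (v : nat -> 'I_N -> {RV P >-> R})
    (s : (nat * 'I_N * 'I_M) + (nat * 'I_N)) : {RV P >-> R} :=
  match s with
  | inl (n, k, a) => u n k a
  | inr (n, k) => v n k
  end.

(* White zero-mean data: each input vector has covariance sigma_u^2 times the
   identity. *)
Definition gaussian_iid_data d (T : measurableType d) (R : realType)
    (P : probability T R) (N M : nat)
    (u : nat -> 'I_N -> 'I_M -> {RV P >-> R}) (v : nat -> 'I_N -> {RV P >-> R})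
    (sigma_u sigma_v : R) : Prop :=
  [/\ forall n k a, is_gaussian (u n k a) 0 sigma_u,
      forall n k, is_gaussian (v n k) 0 sigma_v &
      mutually_independent (source u v)].

(* The family [w n k] indexed by [k], stacked as a column: the entry of index
   [mxtens_index (k, a)] is the entry [a] of block [k]. This is the block
   convention of the Kronecker product [*t]. *)
Definition stack (R : realType) (N M : nat) (w : 'I_N -> 'cV[R]_M)
    : 'cV[R]_(N * M) :=
  \col_r w (mxtens_unindex r).1 (mxtens_unindex r).2 0.

Definition Omega (R : realType) (N : nat) (M : nat) (rho : 'I_N -> R)
    : 'M[R]_(N * M) :=
  diag_mx (\row_k rho k) *t (1%:M : 'M[R]_M).

(* E[X(oo)] is the limit of E[X(n)]; [limn] is only meaningful when this limit
   exists, which is what [has_steady_mean] asserts. *)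
Definition has_steady_mean d (T : measurableType d) (R : realType)
    (P : probability T R) (X : nat -> T -> R) : Prop :=
  cvgn (fun n => fine 'E_P[X n]).

Definition steady_mean d (T : measurableType d) (R : realType)
    (P : probability T R) (X : nat -> T -> R) : R :=
  limn (fun n => fine 'E_P[X n]).

Definition sgn_outer d (T : measurableType d) (R : realType) (N M : nat)
    (w : nat -> 'I_N -> T -> 'cV[R]_M) (i m : 'I_N) (n : nat) (t : T)
    : 'M[R]_M :=
  sgnv (w n i t) *m (sgnv (w n m t))^T.

Definition sgn_correlation d (T : measurableType d) (R : realType)
    (P : probability T R) (N M : nat) (w : nat -> 'I_N -> T -> 'cV[R]_M)
    (i m : 'I_N) : 'M[R]_M :=
  \matrix_(a, b) steady_mean P (fun n t => sgn_outer w i m n t a b).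

Definition beta1 d (T : measurableType d) (R : realType)
    (P : probability T R) (N M : nat) (c : 'M[R]_N) (rho : 'I_N -> R) (mu : R)
    (w : nat -> 'I_N -> T -> 'cV[R]_M) : R :=
  let C := c *t (1%:M : 'M[R]_M) in
  let Om := Omega M rho in
  mu ^+ 2 * steady_mean P (fun n t =>
    let s := sgnv (stack (fun k => w n k t)) in
    (s^T *m Om *m C *m C^T *m Om *m s) 0 0).

(* Main.v *)
(** With [K i m = \sum_j rho_i c_ij rho_m c_mj], the quadratic form in [beta1] is
    the sum over pairs of nodes of [K i m] times the trace of
    [sgn w_i (sgn w_m)^T], and [K i m] vanishes unless [i] and [m] have
    overlapping neighborhoods. Expectation and limit therefore pass through the
    finite sum, (II.B) replaces each correlation by [psi], and by (I.B) the
    total weight is [\sum_j (rho N_s / N)^2 = rho^2 N_s^2 / N]. As the weights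
    are nonnegative, the same computation bounds the error when (II.B) holds
    only up to [eps]. *)
Require Import Defs.
From HB Require Import structures.
From mathcomp Require Import all_boot all_order all_algebra.
From mathcomp Require Import all_classical all_reals all_analysis.
From mathcomp Require Import mxtens.
From mathcomp Require Import measurable_realfun.
From mathcomp Require Import ring.
Import Order.TTheory GRing.Theory Num.Theory.
Import numFieldNormedType.Exports.
Local Open Scope classical_set_scope.
Local Open Scope ring_scope.

(** * Quadratic forms of Kronecker products with an identity factor *)

Section Kronecker.
Context {R : realType} {N M : nat}.

Lemma sum_mxtens (V : nmodType) (F : 'I_(N * M) -> V) :
  \sum_r F r = \sum_i \sum_a F (mxtens_index (i, a)).
Proof.
rewrite pair_bigA (reindex (@mxtens_index N M)) /=; first by apply: eq_bigr => -[].
exact/onW_bij/(Bijective (@mxtens_indexK _ _) (@mxtens_unindexK _ _)).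
Qed.

(** Block [(i, m)] of [K *t 1] is a multiple of the identity, so only equal components of two blocks
    interact. *)
Lemma stack_sqr_form (K : 'M[R]_N) (x : 'I_N -> 'cV[R]_M) :
  ((stack x)^T *m (K *t (1%:M : 'M[R]_M)) *m stack x) 0 0 =
  \sum_i \sum_m K i m * \sum_a x i a 0 * x m a 0.
Proof.
rewrite -mulmxA mxE sum_mxtens; apply: eq_bigr => i _.
under [RHS]eq_bigr do rewrite mulr_sumr.
rewrite exchange_big /=; apply: eq_bigr => a _.
rewrite !mxE mxtens_indexK /= sum_mxtens mulr_sumr; apply: eq_bigr => m _.
rewrite (bigD1 a) //= big1 => [|b /negPf ba].
  by rewrite tensmxE !mxE eqxx mulr1 mxtens_indexK addr0 mulrCA.
by rewrite tensmxE !mxE eq_sym ba mulr0 mul0r.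
Qed.

End Kronecker.

(** Entry [(i, m)] of [D c c^T D], where [D] is the diagonal matrix of [rho]. *)
Definition attraction_weight {R : realType} {N : nat} (c : 'M[R]_N)
    (rho : 'I_N -> R) (i m : 'I_N) : R :=
  \sum_j (rho i * c i j) * (rho m * c m j).

(** The mixed-product rule merges the inner factors into [(D c c^T D) *t 1]. Indexing by triples
    gives one finite sum, to which linearity of the steady mean applies at once. *)
Lemma zero_attraction_form {R : realType} {N M : nat} (c : 'M[R]_N)
    (rho : 'I_N -> R) (x : 'I_N -> 'cV[R]_M) :
  let C := c *t (1%:M : 'M[R]_M) in
  let Om := Omega M rho in
  let s := sgnv (stack x) in
  (s^T *m Om *m C *m C^T *m Om *m s) 0 0 =
  \sum_(q : 'I_N * 'I_N * 'I_M) attraction_weight c rho q.1.1 q.1.2 *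
    (sgnv (x q.1.1) *m (sgnv (x q.1.2))^T) q.2 q.2.
Proof.
move=> C Om s.
pose D := diag_mx (\row_k rho k).
rewrite (_ : s^T *m _ *m _ *m _ *m _ *m s =
  s^T *m (Om *m C *m C^T *m Om) *m s); last by rewrite !mulmxA.
have -> : s = stack (fun k => sgnv (x k)).
  by apply/matrixP => r z; rewrite !mxE.
have -> : Om *m C *m C^T *m Om = (D *m c *m c^T *m D) *t (1%:M : 'M[R]_M).
  by rewrite /C /Om /Omega trmx_tens trmx1 -/D !tensmx_mul !mulmx1.
rewrite stack_sqr_form pair_bigA /= -(pair_bigA _ (fun p a =>
  attraction_weight c rho p.1 p.2 * (sgnv (x p.1) *m (sgnv (x p.2))^T) a a)) /=.
apply: eq_bigr => -[i m] _ /=; rewrite -mulr_sumr; congr (_ * _).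
  (* Since [D] is symmetric, the matrix is [(D c) (D c)^T]. *)
  rewrite -mulmxA -[D as X in _ *m X]tr_diag_mx -trmx_mul mxE.
  by apply: eq_bigr => j _; rewrite !mul_diag_mx !mxE.
by apply: eq_bigr => a _; rewrite [RHS]mxE big_ord1 !mxE.
Qed.

(** * Sign and support of the weights *)

Section Weights.
Context {R : realType} {N : nat} (e : rel 'I_N) (c : 'M[R]_N).
Hypotheses (e_sym : symmetric e) (c_comb : combination_matrix e c).

Lemma combination_matrix_ge0 i j : 0 <= c i j.
Proof.
have [c_gt0 c_0 _] := c_comb j.
by have [/c_gt0/ltW|/c_0->] := boolP (i \in neighborhood e j).
Qed.

Lemma attraction_weight_ge0 rho i m :
  (forall k, 0 <= rho k) -> 0 <= attraction_weight c rho i m.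
Proof.
by move=> rho_ge0; apply: sumr_ge0 => j _; rewrite !mulr_ge0 ?combination_matrix_ge0.
Qed.

Lemma neighborhood_sym i j : (i \in neighborhood e j) = (j \in neighborhood e i).
Proof. by rewrite !inE eq_sym e_sym. Qed.

(** A nonzero term requires a node [j] whose neighborhood contains both [i] and [m]; symmetry of [e]
    then turns [j] into a neighbor of [i]. *)
Lemma attraction_weight_overlapping rho i m :
  attraction_weight c rho i m != 0 -> overlapping e i m.
Proof.
move=> K_neq0.
have [/existsP[j /andP[ij mj]]|/existsPn no_j] :=
    boolP [exists j, (i \in neighborhood e j) && (m \in neighborhood e j)].
  by exists j; rewrite // neighborhood_sym.
case/eqP: K_neq0; apply: big1 => j _; have [_ c_0 _] := c_comb j.
by move: (no_j j); rewrite negb_and => /orP[] /c_0->; rewrite !(mulr0, mul0r).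
Qed.

End Weights.

(** For fixed [j] the double sum over [i] and [m] is the square of the [rho]-weighted sum of column
    [j]. *)
Lemma sum_attraction_weight {R : realType} {N : nat} (c : 'M[R]_N)
    (S : {set 'I_N}) (rho : R) :
  (forall j, \sum_(i in S) c i j = #|S|%:R / N%:R) ->
  \sum_i \sum_m attraction_weight c (zero_attractor S rho) i m =
  rho ^+ 2 * #|S|%:R ^+ 2 / N%:R.
Proof.
move=> c_S.
have col j : \sum_i zero_attractor S rho i * c i j = rho * (#|S|%:R / N%:R).
  rewrite -(c_S j) mulr_sumr [RHS]big_mkcond; apply: eq_bigr => i _.
  by rewrite /zero_attractor; case: ifP => // _; rewrite mul0r.
transitivity (\sum_(j < N) (rho * (#|S|%:R / N%:R)) ^+ 2).
  under eq_bigr do rewrite exchange_big /=.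
  rewrite exchange_big /=; apply: eq_bigr => j _.
  under eq_bigr do rewrite -mulr_sumr.
  by rewrite -mulr_suml !col expr2.
rewrite sumr_const card_ord -[_ *+ N]mulr_natr.
(* For an empty network both sides vanish, as the inverse of 0 is 0. *)
have [->|N_neq0] := eqVneq (N%:R : R) 0; first by rewrite invr0 !mulr0.
by field.
Qed.

(** * Linearity of the steady mean, and integrability *)

Section SteadyMean.
Context d (T : measurableType d) (R : realType) (P : probability T R).

Lemma fine_expectation_sum (I : Type) (r : seq I) (a : I -> R) (X : I -> T -> R) :
  (forall i, X i \in Lfun P 1) ->
  fine 'E_P[fun t => \sum_(i <- r) a i * X i t] =
  \sum_(i <- r) a i * fine 'E_P[X i].
Proof.
move=> X_int.
have aX_int i : P.-integrable setT (fun t => (a i * X i t)%:E).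
  under eq_fun do rewrite EFinM.
  by apply: integrableZl => //; apply/Lfun1_integrable.
rewrite [in LHS]unlock; under eq_integral do rewrite -sumEFin.
rewrite integral_sum //.
have EaX i : (\int[P]_t (a i * X i t)%:E = (a i * fine 'E_P[X i])%:E)%E.
  under eq_integral do rewrite EFinM.
  rewrite integralZl //; last exact/Lfun1_integrable.
  by rewrite EFinM fineK ?expectation_fin_num // unlock.
by under eq_bigr do rewrite EaX; rewrite sumEFin.
Qed.

(** Convergence is required only where [a i] is nonzero: sign correlations of non-overlapping nodes
    need not converge, but their weight is zero. *)
Lemma steady_mean_sum (I : finType) (a : I -> R) (X : I -> nat -> T -> R) :
  (forall i n, X i n \in Lfun P 1) ->
  (forall i, a i != 0 -> has_steady_mean P (X i)) ->
  steady_mean P (fun n t => \sum_i a i * X i n t) =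
  \sum_i a i * steady_mean P (X i).
Proof.
move=> X_int X_cvg; apply: cvg_lim => //.
under eq_fun do rewrite fine_expectation_sum //.
apply: cvg_big => [|i _]; first exact: add_continuous.
have [->|/X_cvg aX] := eqVneq (a i) 0.
  by under eq_fun do rewrite mul0r; rewrite mul0r; exact: cvg_cst.
exact: cvgMl_tmp.
Qed.

Lemma bounded_Lfun1 (f : T -> R) (b : R) : measurable_fun setT f ->
  (forall t, `|f t| <= b) -> f \in Lfun P 1.
Proof.
move=> f_meas f_le; apply/Lfun1_integrable/measurable_bounded_integrable => //.
  by apply: le_lt_trans (probability_le1 P measurableT) _; rewrite ltry.
exists b; split; first exact: num_real.
by move=> y by_ t _ /=; rewrite (le_trans (f_le t)) ?ltW.
Qed.

Lemma measurable_sgr (f : T -> R) :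
  measurable_fun setT f -> measurable_fun setT (fun t => Num.sg (f t)).
Proof.
move=> f_meas; rewrite (_ : (fun t => _) =
    fun t => if 0 < f t then 1 else if f t < 0 then -1 else 0).
  apply: measurable_fun_ifT => //; first exact: measurable_fun_ltr.
  by apply: measurable_fun_ifT => //; exact: measurable_fun_ltr.
by apply/funext => t; case: sgrP.
Qed.

Context (N M : nat) (e : rel 'I_N) (c : 'M[R]_N) (rho : 'I_N -> R) (mu : R).
Context (w0 : 'cV[R]_M) (u : nat -> 'I_N -> 'I_M -> {RV P >-> R}).
Context (v : nat -> 'I_N -> {RV P >-> R}) (w_init : 'I_N -> 'I_M -> {RV P >-> R}).

Local Notation w := (estimate e c rho mu w0 u v w_init).

(** By induction on [n]: each recursion step combines measurable functions by sums, products and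
    signs. *)
Lemma measurable_estimate n k a : measurable_fun setT (fun t => w n k t a 0).
Proof.
elim: n k a => [|n IHn] k a.
  by rewrite /estimate /=; under eq_fun do rewrite mxE; exact: measurable_funPT.
(* One recursion step in scalar form, summed over a list as [measurable_sum] expects. *)
rewrite (_ : (fun t => _) = fun t => \sum_(j <- enum (neighborhood e k)) c j k *
  (w n j t a 0 + mu * (\sum_b u n j b t * w0 b 0 + v n j t
     - \sum_b w n j t b 0 * u n j b t) * u n j a t
     - rho j * Num.sg (w n j t a 0))).
  apply: measurable_sum => j; apply: measurable_funM => //.
  apply: measurable_funB; last first.
    by apply: measurable_funM => //; apply: measurable_sgr.
  apply: measurable_funD => //; apply: measurable_funM => //.
  apply: measurable_funM => //; apply: measurable_funB.
    apply: measurable_funD => //; apply: measurable_sum => b.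
    exact: measurable_funM.
  by apply: measurable_sum => b; exact: measurable_funM.
apply/funext => t; rewrite big_enum /= /estimate /= summxE.
apply: eq_bigr => j _; rewrite /adapt /observation !mxE.
congr (_ * (_ + _ * (_ + _ - _) * _ - _)); by apply: eq_bigr => b _; rewrite !mxE.
Qed.

(** Signs are bounded by 1, so no moment bound on the estimates is involved. *)
Lemma sgn_outer_Lfun1 i m n a b :
  (fun t => sgn_outer w i m n t a b) \in Lfun P 1.
Proof.
rewrite (_ : (fun t => _) =
    fun t => Num.sg (w n i t a 0) * Num.sg (w n m t b 0)).
  apply: (bounded_Lfun1 _ 1) => [|t].
    by apply: measurable_funM; apply: measurable_sgr; exact: measurable_estimate.
  by rewrite normrM !normr_sg; case: eqP; case: eqP; rewrite ?(mulr1, mulr0).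
by apply/funext => t; rewrite /sgn_outer mxE big_ord1 !mxE.
Qed.

End SteadyMean.

Theorem theorem2 (d : measure_display) (T : measurableType d) (R : realType)
    (P : probability T R) (N M : nat) (e : rel 'I_N) (c : 'M[R]_N)
    (S : {set 'I_N}) (mu rho sigma_u sigma_v : R) (w0 : 'cV[R]_M)
    (u : nat -> 'I_N -> 'I_M -> {RV P >-> R})
    (v : nat -> 'I_N -> {RV P >-> R})
    (w_init : 'I_N -> 'I_M -> {RV P >-> R})
    (psi : 'M[R]_M)
    (w := estimate e c (zero_attractor S rho) mu w0 u v w_init)
    (beta1_inf := beta1 P c (zero_attractor S rho) mu w)
    (value := mu ^+ 2 * rho ^+ 2 * \tr psi * #|S|%:R ^+ 2 / N%:R) :
  connected_network e ->
  combination_matrix e c ->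
  0 < mu -> 0 < rho -> 0 < sigma_u -> 0 < sigma_v ->
  gaussian_iid_data u v sigma_u sigma_v ->
  (forall i m, overlapping e i m -> forall a b,
     has_steady_mean P (fun n t => sgn_outer w i m n t a b)) ->
  (* (I.A) *)
  doubly_stochastic c ->
  (* (I.B) *)
  (forall j, \sum_(i in S) c i j = #|S|%:R / N%:R) ->
  (* (II.B), first with equality, then up to a tolerance *)
  ((forall i m, overlapping e i m -> sgn_correlation P w i m = psi) ->
   beta1_inf = value)
  /\
  (forall eps : R, 0 <= eps ->
   (forall i m, overlapping e i m -> forall a b,
      `|sgn_correlation P w i m a b - psi a b| <= eps) ->
   `|beta1_inf - value| <=
     mu ^+ 2 * rho ^+ 2 * (M%:R * eps) * #|S|%:R ^+ 2 / N%:R).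
Proof.
move=> [e_sym _ _] c_comb _ rho_gt0 _ _ _ w_cvg _ c_S.
pose K := attraction_weight c (zero_attractor S rho).
have K_ge0 i m : 0 <= K i m.
  apply: (attraction_weight_ge0 e c c_comb) => k.
  by rewrite /zero_attractor; case: ifP => // _; exact: ltW.
(* Used twice: the diagonal of [psi] as [F] yields [value], the constant [eps] yields the error
   bound. *)
have sum_K (F : 'I_M -> R) : \sum_(q : 'I_N * 'I_N * 'I_M) K q.1.1 q.1.2 * F q.2 =
    (\sum_a F a) * (rho ^+ 2 * #|S|%:R ^+ 2 / N%:R).
  rewrite -(sum_attraction_weight c S rho c_S) mulrC pair_bigA mulr_suml.
  rewrite -(pair_bigA _ (fun p a => K p.1 p.2 * F a)) /=.
  by apply: eq_bigr => p _; rewrite mulr_sumr.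
have beta1E : beta1_inf = mu ^+ 2 * \sum_(q : 'I_N * 'I_N * 'I_M)
    K q.1.1 q.1.2 * sgn_correlation P w q.1.1 q.1.2 q.2 q.2.
  rewrite /beta1_inf /beta1; congr (_ * _).
  rewrite (_ : (fun n t => _) = fun n t => \sum_(q : 'I_N * 'I_N * 'I_M)
      K q.1.1 q.1.2 * sgn_outer w q.1.1 q.1.2 n t q.2 q.2); last first.
    by apply/funext => n; apply/funext => t; rewrite zero_attraction_form.
  rewrite steady_mean_sum => [|q n|q K_neq0].
  - by apply: eq_bigr => q _; rewrite mxE.
  - exact: sgn_outer_Lfun1.
  - exact/w_cvg/(attraction_weight_overlapping e c e_sym c_comb _ _ _ K_neq0).
have tol (eps : R) : 0 <= eps ->
   (forall i m, overlapping e i m -> forall a b,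
      `|sgn_correlation P w i m a b - psi a b| <= eps) ->
   `|beta1_inf - value| <=
     mu ^+ 2 * rho ^+ 2 * (M%:R * eps) * #|S|%:R ^+ 2 / N%:R.
  move=> _ psi_eps.
  have -> : value = mu ^+ 2 * \sum_(q : 'I_N * 'I_N * 'I_M) K q.1.1 q.1.2 * psi q.2 q.2.
    by rewrite (sum_K (fun a => psi a a)) /value /mxtrace; ring.
  rewrite beta1E -mulrBr -sumrB normrM (ger0_norm (sqr_ge0 mu)).
  rewrite [leRHS](_ : _ = mu ^+ 2 * \sum_(q : 'I_N * 'I_N * 'I_M) K q.1.1 q.1.2 * eps).
    apply: ler_wpM2l; first exact: sqr_ge0.
    apply: le_trans (ler_norm_sum _ _ _) _; apply: ler_sum => q _.
    rewrite -mulrBr normrM (ger0_norm (K_ge0 _ _)).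
    (* The tolerance is known only for overlapping pairs; every other pair has weight zero. *)
    have [->|K_neq0] := eqVneq (K q.1.1 q.1.2) 0; first by rewrite !mul0r.
    apply: ler_wpM2l => //; apply: psi_eps.
    exact: (attraction_weight_overlapping e c e_sym c_comb _ _ _ K_neq0).
  by rewrite (sum_K (fun=> eps)) sumr_const card_ord -mulr_natl; ring.
(* The exact statement is the tolerance bound at [eps = 0]. *)
split=> // psi_eq; apply/eqP; rewrite -subr_eq0 -normr_le0.
apply: le_trans (tol 0 (lexx 0) _) _; last by rewrite !(mulr0, mul0r).
by move=> i m /psi_eq-> a b; rewrite subrr normr0.
Qed.
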